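(* Consider the one-dimensional problem $\min\{0\cdot x : x=0,\ x\in\mathbb R\}$, i.e. the saddle point problem $\min_{x\in\mathbb R}\max_{y\in\mathbb R}\mathcal L(x,y)$ with $\mathcal L(x,y)=-yx$ (so $A=1$ and $\rho(A^TA)=1$), and apply the CP-PPA to it with $s=1$. Then for every $r$ with $0<r<0.75$ the CP-PPA is divergent: there is a starting point $(x^0,y^0)\in\mathbb R^2$ for which the generated sequence $\{(x^k,y^k)\}$ does not converge. Consequently, for every constant $c$ with $0<c<0.75$, there exist a linear equality constrained convex problem $\min\{f(x): Ax=b,\ x\in\mathcal X\}$ and parameters $r,s>0$ with $r\cdot s>c\,\rho(A^TA)$ such that the CP-PPA applied to the saddle point problem of its Lagrangian $f(x)-y^T(Ax-b)$ is divergent; that is, the constant $0.75$ in the condition $r\cdot s>0.75\,\rho(A^TA)$ cannot be replaced by any smaller positive number.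
   Context: For a saddle point problem $\min_{x\in\mathcal X}\max_{y\in\mathcal Y}\mathcal L(x,y)$ with $\mathcal L(x,y)=f(x)-y^TAx-g(y)$, where $\mathcal X\subseteq\mathbb R^n$, $\mathcal Y\subseteq\mathbb R^m$ are closed convex sets, $f,g$ are convex and $A\in\mathbb R^{m\times n}$, the CP-PPA (the Chambolle–Pock primal-dual algorithm) with parameters $r,s>0$ generates, for $k=0,1,2,\dots$, $$x^{k+1}=\arg\min\{\mathcal L(x,y^k)+\tfrac r2\|x-x^k\|^2: x\in\mathcal X\},$$ $$\bar x^{k+1}=2x^{k+1}-x^k,$$ $$y^{k+1}=\arg\max\{\mathcal L(\bar x^{k+1},y)-\tfrac s2\|y-y^k\|^2: y\in\mathcal Y\},$$ where in the last step the term $f(\bar x^{k+1})$ is constant in $y$ and is dropped. The Lagrangian $f(x)-y^T(Ax-b)$ of $\min\{f(x):Ax=b,\ x\in\mathcal X\}$ is of this form with $g(y)=-b^Ty$ and $\mathcal Y=\mathbb R^m$. $\rho(A^TA)$ is the largest eigenvalue of $A^TA$. *)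

(* Defs.v *)
From HB Require Import structures.
From mathcomp Require Import all_boot all_order all_algebra.
From mathcomp Require Import all_classical all_reals all_analysis.

Set Implicit Arguments.
Unset Strict Implicit.
Unset Printing Implicit Defensive.

Import Order.TTheory GRing.Theory Num.Theory.
Import numFieldNormedType.Exports.

Local Open Scope classical_set_scope.
Local Open Scope ring_scope.

(* The norm that the library puts on 'cV[R]_n is the sup norm, hence the
   explicit Euclidean inner product; inner u u is the squared Euclidean norm. *)
Definition inner (R : realType) (n : nat) (u v : 'cV[R]_n) : R :=
  (u^T *m v) 0 0.

Definition argmin (R : realType) (T : Type) (D : set T) (h : T -> R) : set T :=
  [set x | D x /\ forall z, D z -> h x <= h z].

Definition argmax (R : realType) (T : Type) (D : set T) (h : T -> R) : set T :=
  [set x | D x /\ forall z, D z -> h z <= h x].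

Definition is_largest_eigenvalue (R : realType) (n : nat) (M : 'M[R]_n)
    (rho : R) : Prop :=
  eigenvalue M rho /\ forall a, eigenvalue M a -> a <= rho.

(* min over x in X, max over y in Y, of f x - y^T A x - g y *)
Record saddleProblem (R : realType) (n m : nat) := SaddleProblem {
  sp_f : 'cV[R]_n -> R;
  sp_g : 'cV[R]_m -> R;
  sp_A : 'M[R]_(m, n);
  sp_X : set 'cV[R]_n;
  sp_Y : set 'cV[R]_m
}.

Definition lagrangian (R : realType) (n m : nat) (P : saddleProblem R n m)
    (x : 'cV[R]_n) (y : 'cV[R]_m) : R :=
  sp_f P x - inner y (sp_A P *m x) - sp_g P y.

Definition is_saddle_point (R : realType) (n m : nat) (P : saddleProblem R n m)
    (x : 'cV[R]_n) (y : 'cV[R]_m) : Prop :=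
  argmin (sp_X P) (fun x' => lagrangian P x' y) x /\
  argmax (sp_Y P) (fun y' => lagrangian P x y') y.

(* min { f x : A x = b, x in X } *)
Record linConstrProblem (R : realType) (n m : nat) := LinConstrProblem {
  lc_f : 'cV[R]_n -> R;
  lc_A : 'M[R]_(m, n);
  lc_b : 'cV[R]_m;
  lc_X : set 'cV[R]_n
}.

Definition is_convex_problem (R : realType) (n m : nat)
    (Q : linConstrProblem R n m) : Prop :=
  [/\ convex_function [set: 'cV[R]_n] (lc_f Q),
      closed (lc_X Q) & convex_set (lc_X Q)].

(* f x - y^T (A x - b) = f x - y^T A x - g y with g y = - b^T y *)
Definition saddle_of (R : realType) (n m : nat) (Q : linConstrProblem R n m) :
    saddleProblem R n m :=
  {| sp_f := lc_f Q;
     sp_g := fun y => - inner (lc_b Q) y;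
     sp_A := lc_A Q;
     sp_X := lc_X Q;
     sp_Y := [set: 'cV[R]_m] |}.

(* One iteration (x, y) |-> (x', y').  In the y-step the term f (2 x' - x),
   which does not depend on the maximization variable, is dropped. *)
Definition cpppa_step (R : realType) (n m : nat) (P : saddleProblem R n m)
    (r s : R) (x : 'cV[R]_n) (y : 'cV[R]_m)
    (x' : 'cV[R]_n) (y' : 'cV[R]_m) : Prop :=
  argmin (sp_X P)
    (fun z => lagrangian P z y + r / 2 * inner (z - x) (z - x)) x' /\
  let xbar := 2 *: x' - x in
  argmax (sp_Y P)
    (fun w => - inner w (sp_A P *m xbar) - sp_g P w
              - s / 2 * inner (w - y) (w - y)) y'.

Definition cpppa_sequence (R : realType) (n m : nat) (P : saddleProblem R n m)
    (r s : R) (x0 : 'cV[R]_n) (y0 : 'cV[R]_m)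
    (x : nat -> 'cV[R]_n) (y : nat -> 'cV[R]_m) : Prop :=
  [/\ x 0%N = x0, y 0%N = y0 &
      forall k, cpppa_step P r s (x k) (y k) (x k.+1) (y k.+1)].

(* For some starting point the algorithm runs forever and its iterates do not
   converge.  The first conjunct prevents the second from being vacuous. *)
Definition cpppa_divergent (R : realType) (n m : nat)
    (P : saddleProblem R n m) (r s : R) : Prop :=
  exists (x0 : 'cV[R]_n) (y0 : 'cV[R]_m),
    (exists (x : nat -> 'cV[R]_n) (y : nat -> 'cV[R]_m),
        cpppa_sequence P r s x0 y0 x y) /\
    (forall (x : nat -> 'cV[R]_n) (y : nat -> 'cV[R]_m),
        cpppa_sequence P r s x0 y0 x y ->
        ~ exists l : 'cV[R]_n * 'cV[R]_m, (fun k => (x k, y k)) @ \oo --> l).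

(* min { 0 * x : x = 0, x in R }, with R identified with 'cV[R]_1 *)
Definition zeroProblem (R : realType) : linConstrProblem R 1 1 :=
  {| lc_f := fun x => 0 * x 0 0;
     lc_A := 1%:M;
     lc_b := 0;
     lc_X := [set: 'cV[R]_1] |}.

(* Main.v *)
Require Import Defs.
From HB Require Import structures.
From mathcomp Require Import all_boot all_order all_algebra.
From mathcomp Require Import all_classical all_reals all_analysis.
From mathcomp Require Import ring lra.

Set Implicit Arguments.
Unset Strict Implicit.
Unset Printing Implicit Defensive.

Import Order.TTheory GRing.Theory Num.Theory.
Import numFieldNormedType.Exports.

Local Open Scope classical_set_scope.
Local Open Scope ring_scope.

(** For [A = 1] and [s = 1] the CP-PPA is the linear map
    [(x, y) |-> (x + t y, - x + (1 - 2 t) y)] with [t = 1 / r].  Its characteristic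
    polynomial [l ^ 2 - (2 - 2 t) l + (1 - t)] takes the value [4 - 3 t] at [-1],
    which is negative exactly when [r < 3 / 4]; there is then a real eigenvalue
    [l < -1], and starting from an eigenvector the iterates are multiplied by [l]
    at each step. *)

Lemma inner1E (R : realType) (u v : 'cV[R]_1) : inner u v = u 0 0 * v 0 0.
Proof. by rewrite /inner mxE big_ord1 mxE. Qed.

Lemma argmaxN (R : realType) (T : Type) (D : set T) (h : T -> R) :
  argmax D h = argmin D (fun z => - h z).
Proof.
by apply/seteqP; split=> x [Dx hx]; split=> // z Dz; move: (hx z Dz); rewrite lerN2.
Qed.

Lemma argmin_quadratic (R : realType) (a m c : R) (h : 'cV[R]_1 -> R)
    (x : 'cV[R]_1) :
  0 < a -> (forall z, h z = a * (z 0 0 - m) ^+ 2 + c) ->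
  argmin [set: 'cV[R]_1] h x <-> x 0 0 = m.
Proof.
(* Testing minimality against the vertex [m] alone forces the square to vanish. *)
move=> a0 hE; split=> [[_ /(_ (const_mx m) I)]|xm].
  rewrite !hE mxE subrr expr0n mulr0 add0r gerDr pmulr_rle0 //.
  by rewrite real_exprn_even_le0 ?num_real //= => /eqP/subr0_eq.
split=> // z _; rewrite !hE xm subrr expr0n mulr0 add0r lerDr.
by rewrite mulr_ge0 ?sqr_ge0 // ltW.
Qed.

Lemma argmax_quadratic (R : realType) (a m c : R) (h : 'cV[R]_1 -> R)
    (x : 'cV[R]_1) :
  0 < a -> (forall z, h z = c - a * (z 0 0 - m) ^+ 2) ->
  argmax [set: 'cV[R]_1] h x <-> x 0 0 = m.
Proof.
move=> a0 hE; rewrite argmaxN; apply: (@argmin_quadratic _ a m (- c)) => // z.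
by rewrite hE opprB.
Qed.

Lemma lagrangian_zeroProblem (R : realType) (x y : 'cV[R]_1) :
  lagrangian (saddle_of (zeroProblem R)) x y = - (y 0 0 * x 0 0).
Proof. by rewrite /lagrangian /= mul1mx !inner1E mxE !mul0r oppr0 subr0 add0r. Qed.

(** Both subproblems are scalar quadratics, so completing the square yields their unique optimizers.
    The additive constants supplied in the proof are the optimal values. *)
Lemma cpppa_step_zeroProblem (R : realType) (r s : R) (x y x' y' : 'cV[R]_1) :
  0 < r -> 0 < s ->
  cpppa_step (saddle_of (zeroProblem R)) r s x y x' y' <->
  x' 0 0 = x 0 0 + y 0 0 / r /\
  y' 0 0 = y 0 0 - (2 * x' 0 0 - x 0 0) / s.
Proof.
move=> r0 s0; have rN0 := lt0r_neq0 r0; have sN0 := lt0r_neq0 s0.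
rewrite /cpppa_step /=.
rewrite (@argmin_quadratic _ (r / 2) (x 0 0 + y 0 0 / r)
  (- (y 0 0 * x 0 0) - (y 0 0) ^+ 2 / (2 * r))); first last.
- by move=> z; rewrite lagrangian_zeroProblem inner1E !mxE; field.
- by rewrite divr_gt0.
rewrite (@argmax_quadratic _ (s / 2) (y 0 0 - (2 * x' 0 0 - x 0 0) / s)
  (- (y 0 0 * (2 * x' 0 0 - x 0 0)) + (2 * x' 0 0 - x 0 0) ^+ 2 / (2 * s))) //.
- by rewrite divr_gt0.
by move=> z; rewrite mul1mx !inner1E !mxE; field.
Qed.

(** The absolute values never fall below that of [u 0], whereas a limit would be fixed by
    multiplication by [l] and hence be zero. *)
Lemma cvg_ratioN1 (R : realType) (u : nat -> R) (l L : R) :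
  l < -1 -> (forall k, u k.+1 = l * u k) -> u 0%N != 0 ->
  ~ (u @ \oo --> L).
Proof.
move=> l1 uS u0 uL.
have uge k : `|u 0%N| <= `|u k|.
  elim: k => // k /le_trans; apply.
  by rewrite uS normrM ler_peMl // ltr0_norm; lra.
have L0 : L = 0.
  have : L = l * L.
    apply: (@cvg_unique _ (@Rhausdorff R) (u k.+1 @[k --> \oo])).
    - by rewrite /= (cvg_shiftS u).
    - rewrite /=; under eq_fun do rewrite uS.
      by apply: cvgMr.
  by move=> LlL; nra.
have uN : `|u k| @[k --> \oo] --> `|L| by apply: cvg_norm.
have : `|u 0%N| <= `|L|.
  rewrite -(cvg_lim _ uN) //; apply: limr_ge; first by apply/cvg_ex; exists `|L|.
  by apply: nearW.
by rewrite L0 normr0 normr_le0 (negPf u0).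
Qed.

Lemma largest_eigenvalue_zeroProblem (R : realType) :
  is_largest_eigenvalue ((lc_A (zeroProblem R))^T *m lc_A (zeroProblem R)) 1.
Proof.
rewrite /= trmx1 mulmx1; split=> [|a].
  apply/eigenvalueP; exists 1%:M; first by rewrite mulmx1 scale1r.
  exact: oner_neq0.
move=> /eigenvalueP[v]; rewrite mulmx1 => va v0.
have /eqP : (1 - a) *: v = 0 by rewrite scalerBl scale1r -va subrr.
by rewrite scaler_eq0 (negPf v0) orbF subr_eq0 => /eqP <-.
Qed.

Lemma zeroProblem_divergent (R : realType) (r : R) :
  0 < r -> r < 3 / 4 -> cpppa_divergent (saddle_of (zeroProblem R)) r 1.
Proof.
move=> r0 r34; set t := r^-1.
have t43 : 4 / 3 < t.
  by rewrite /t -[ltLHS]invrK ltf_pV2 ?posrE ?invr_gt0 ?divr_gt0 // invf_div.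
(* A quarter of the discriminant of the characteristic polynomial is [t ^+ 2 - t], so [l] is its
   smaller root. *)
pose d := Num.sqrt (t ^+ 2 - t); pose l := 1 - t - d.
have d2 : d ^+ 2 = t ^+ 2 - t by rewrite sqr_sqrtr //; nra.
have d0 : 0 <= d by exact: sqrtr_ge0.
(* Equivalent to [2 - t < d], which holds since [d ^+ 2 - (2 - t) ^+ 2 = 3 * t - 4] is positive. *)
have l1 : l < -1 by rewrite /l; nra.
have chi : l ^+ 2 = (2 - 2 * t) * l - (1 - t) by rewrite /l; nra.
have stepE x y x' y' :
    cpppa_step (saddle_of (zeroProblem R)) r 1 x y x' y' <->
    x' 0 0 = x 0 0 + t * y 0 0 /\ y' 0 0 = (1 - 2 * t) * y 0 0 - x 0 0.
  rewrite cpppa_step_zeroProblem // divr1 [_ / r]mulrC -/t.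
  by split=> -[-> ->]; split; ring.
(* An eigenvector for [l]: the first row of the map requires [t * y = (l - 1) * x]. *)
exists (const_mx t), (const_mx (l - 1)); split.
  exists (fun k => const_mx (l ^+ k * t)), (fun k => const_mx (l ^+ k * (l - 1))).
  split=> [||k]; rewrite ?expr0 ?mul1r //.
  apply/stepE; rewrite !mxE !exprS; split; first by ring.
  have -> : l * l ^+ k * (l - 1) = l ^+ k * (l ^+ 2 - l) by ring.
  by rewrite chi; ring.
move=> x y [x0 y0 xyS] [[lx ly] xyl].
(* Divergence concerns every run from this start, so an arbitrary run is shown to stay on the
   eigenline; its [x]-coordinates are then geometric with ratio [l]. *)
have eigenline k : t * y k 0 0 = (l - 1) * x k 0 0.
  elim: k => [|k IH]; first by rewrite x0 y0 !mxE mulrC.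
  have /stepE[-> ->] := xyS k.
  rewrite mulrBr mulrCA mulrDr IH.
  have -> : (1 - 2 * t) * ((l - 1) * x k 0 0) - t * x k 0 0 =
            (l - 1 - 2 * t * l + t) * x k 0 0 by ring.
  have -> : (l - 1) * x k 0 0 + (l - 1) * ((l - 1) * x k 0 0) =
            (l ^+ 2 - l) * x k 0 0 by ring.
  by rewrite chi; ring.
apply: (@cvg_ratioN1 _ (fun k => x k 0 0) l (lx 0 0)) => //.
- by move=> k; have /stepE[-> _] := xyS k; rewrite eigenline; ring.
- by rewrite x0 mxE gt_eqF //; lra.
have xl : x @ \oo --> lx.
  exact: (@cvg_comp _ _ _ _ fst _ _ _ xyl cvg_fst).
exact: (@cvg_comp _ _ _ x (fun M : 'cV[R]_1 => M 0 0) _ _ _ xl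
  (@coord_continuous _ _ _ 0 0 lx)).
Qed.

Theorem mainTheorem2 (R : realType) :
  [/\ forall x y : 'cV[R]_1,
        lagrangian (saddle_of (zeroProblem R)) x y = - (y 0 0 * x 0 0),
      is_largest_eigenvalue ((lc_A (zeroProblem R))^T *m lc_A (zeroProblem R)) 1,
      forall r : R, 0 < r -> r < 3 / 4 ->
        cpppa_divergent (saddle_of (zeroProblem R)) r 1
    & forall c : R, 0 < c -> c < 3 / 4 ->
        exists (n m : nat) (Q : linConstrProblem R n m) (r s rho : R),
          is_convex_problem Q /\
          (exists x y, is_saddle_point (saddle_of Q) x y) /\
          0 < r /\ 0 < s /\
          is_largest_eigenvalue ((lc_A Q)^T *m lc_A Q) rho /\
          c * rho < r * s /\
          cpppa_divergent (saddle_of Q) r s ].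
Proof.
split; [exact: lagrangian_zeroProblem | exact: largest_eigenvalue_zeroProblem
       | exact: zeroProblem_divergent |] => c c0 c34.
(* With [s] and [rho] equal to 1, [r] need only lie strictly between [c] and [3 / 4]: the midpoint
   is taken. *)
exists 1%N, 1%N, (zeroProblem R), ((c + 3 / 4) / 2), 1, 1.
split.
  split; [|exact: closedT|by move=> x y k _ _; rewrite inE].
  by move=> k x y _ _ /=; rewrite !mul0r convmm.
split.
  (* The origin is a saddle point because the Lagrangian vanishes as soon as either argument is
     zero. *)
  by exists 0, 0; split; split=> // z _; rewrite !lagrangian_zeroProblem !mxE mulr0 mul0r.
split; first lra.
split=> //.
split; first exact: largest_eigenvalue_zeroProblem.
split; first lra.
by apply: zeroProblem_divergent; lra.
Qed.
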